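(* Let $n,K\ge 1$ be integers, let $\pi_1,\dots,\pi_K>0$ with $\sum_{c=1}^K\pi_c=1$, and let $f_1,\dots,f_K$ be probability densities on $\mathbb{R}^n$ (with respect to Lebesgue measure). Let $C$ be a random variable on $\{1,\dots,K\}$ with $\mathbb{P}(C=c)=\pi_c$, and let $X\in\mathbb{R}^n$ be such that, conditionally on $C=c$, $X$ has density $f_c$; thus $X$ has the mixture density $p_X(x)=\sum_{c=1}^K\pi_c f_c(x)$. Assume that the differential entropies $h(X)$ and $h(f_1),\dots,h(f_K)$ exist and are finite. Then $$h(X)=h(X\mid C)+I(X;C).$$
   Context: For a probability density $f$ on $\mathbb{R}^n$, the differential entropy (in bits) is $h(f)=-\int_{\mathbb{R}^n} f(x)\log_2 f(x)\,dx$, with the convention $0\log_2 0=0$; $h(X)$ denotes $h(p_X)$. The conditional entropy is $h(X\mid C)=\sum_{c=1}^K\pi_c h(f_c)$. Also $H(C)=-\sum_{c=1}^K\pi_c\log_2\pi_c$, and $$H(C\mid X)=-\int_{\mathbb{R}^n}p_X(x)\sum_{c=1}^K\mathbb{P}(C=c\mid X=x)\log_2\mathbb{P}(C=c\mid X=x)\,dx,$$ where $\mathbb{P}(C=c\mid X=x)=\pi_c f_c(x)/p_X(x)$ wherever $p_X(x)>0$. The mutual information (in bits) between the continuous $X$ and the discrete $C$ is $I(X;C)=H(C)-H(C\mid X)$. *)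

(* Defs.v *)
(* R^n is n.-tuple R with its Borel (product) sigma-algebra. *)
From HB Require Import structures.
From mathcomp Require Import all_boot all_order all_algebra.
From mathcomp Require Import all_classical all_reals all_analysis.

Set Implicit Arguments.
Unset Strict Implicit.
Unset Printing Implicit Defensive.
Import Order.TTheory GRing.Theory Num.Theory.
Import numFieldNormedType.Exports.

Local Open Scope classical_set_scope.
Local Open Scope ring_scope.

Section lebesgue_tuple.
Context (R : realType).

(* The source uses [measurableTypeR R], the type on which [lebesgue_measure] is
   a measure; its measurable sets are those of R. *)
Definition cons_pair (n : nat) (p : measurableTypeR R * n.-tuple R) :
    n.+1.-tuple R :=
  [the n.+1.-tuple R of p.1 :: p.2].

Lemma measurable_cons_pair n : measurable_fun setT (@cons_pair n).
Proof. exact: measurable_cons. Qed.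

Section cons_measure.
Context (n : nat) (mu : {sigma_finite_measure set (n.-tuple R) -> \bar R}).

Definition cons_measure : set (n.+1.-tuple R) -> \bar R :=
  pushforward (@lebesgue_measure R \x mu)%E (@cons_pair n).

Let measurable_preimage A : measurable A -> measurable (@cons_pair n @^-1` A).
Proof.
by move=> mA; rewrite -[X in measurable X]setTI; exact: measurable_cons_pair.
Qed.

Let cons_measure0 : cons_measure set0 = 0%E.
Proof. by rewrite /cons_measure /pushforward preimage_set0 measure0. Qed.

Let cons_measure_ge0 A : (0 <= cons_measure A)%E.
Proof. by rewrite /cons_measure /pushforward; apply: integral_ge0. Qed.

Let cons_measure_sigma_additive : semi_sigma_additive cons_measure.
Proof.
move=> F mF tF mUF; rewrite /cons_measure /pushforward preimage_bigcup.
apply: measure_semi_sigma_additive.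
- by move=> k; exact: measurable_preimage.
- apply/trivIsetP => i j _ _ ij; rewrite -preimage_setI.
  by move/trivIsetP : tF => /(_ _ _ _ _ ij) ->//; rewrite preimage_set0.
- by rewrite -preimage_bigcup; exact: measurable_preimage.
Qed.

HB.instance Definition _ := isMeasure.Build _ _ _ cons_measure
  cons_measure0 cons_measure_ge0 cons_measure_sigma_additive.

Let cons_measure_sigma_finite : sigma_finite setT cons_measure.
Proof.
have /sigma_finiteP[F [TF ndF Foo]] := sigma_finiteT (@lebesgue_measure R).
have /sigma_finiteP[G [TG ndG Goo]] := sigma_finiteT mu.
pose u (t : n.+1.-tuple R) : R * n.-tuple R := (thead t, [tuple of behead t]).
have uK : cancel (@cons_pair n) u.
  move=> [x t]; rewrite /u /cons_pair/=; congr pair.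
  exact/val_inj.
have mu_ : measurable_fun setT u.
  apply/measurable_fun_pairP; split => /=.
    exact: measurable_tnth.
  exact: measurable_behead.
exists (fun k => u @^-1` (F k `*` G k)).
  apply/esym; rewrite -subTset => t _.
  have [i _ Fi] : (\bigcup_i F i) (u t).1 by rewrite -TF.
  have [j _ Gj] : (\bigcup_i G i) (u t).2 by rewrite -TG.
  exists (maxn i j) => //; split.
    by move: (u t).1 Fi; exact/subsetPset/ndF/leq_maxl.
  by move: (u t).2 Gj; exact/subsetPset/ndG/leq_maxr.
move=> k; have [mF Fk] := Foo k; have [mG Gk] := Goo k; split.
  by rewrite -[X in measurable X]setTI; apply: mu_ => //; exact: measurableX.
rewrite /cons_measure /pushforward -comp_preimage.
rewrite (_ : u \o _ = id) ?preimage_id; last by apply/funext => x; exact: uK.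
by rewrite product_measure1E// lte_mul_pinfty// ge0_fin_numE.
Qed.

HB.instance Definition _ := Measure_isSigmaFinite.Build _ _ _ cons_measure
  cons_measure_sigma_finite.

End cons_measure.

(* Lebesgue measure on R^n (restricted to Borel sets) as the n-fold product of the one on R. *)
Fixpoint lebesgue_tuple n : {sigma_finite_measure set (n.-tuple R) -> \bar R} :=
  match n with
  | 0 => \d_ ([tuple] : 0.-tuple R)
  | m.+1 => cons_measure (lebesgue_tuple m)
  end.

Lemma lebesgue_tuple_box n (A : 'I_n -> set R) :
  (forall i, measurable (A i)) ->
  lebesgue_tuple n [set t | forall i, A i (tnth t i)] =
  (\prod_(i < n) lebesgue_measure (A i))%E.
Proof.
elim: n A => [|n IHn] A mA /=.
  rewrite big_ord0 diracE mem_set//=; by case.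
rewrite big_ord_recl /cons_measure/= /pushforward.
rewrite (_ : _ @^-1` _ =
  A ord0 `*` [set t | forall i : 'I_n, A (lift ord0 i) (tnth t i)]); last first.
  apply/seteqP; split => [[x t] /= h|[x t] /= [Ax At] i].
    split; first exact: (h ord0).
    by move=> i; have := h (lift ord0 i); rewrite tnthS.
  by have [j ->|->//] := unliftP ord0 i; rewrite tnthS; exact: At.
rewrite product_measure1E//; last 2 first.
  exact: (mA ord0).
  rewrite (_ : mkset _ = \bigcap_(i in [set: 'I_n])
      ((fun t => tnth t i) @^-1` A (lift ord0 i))); last first.
    by apply/seteqP; split => [t + i _|t + i]; exact.
  apply: fin_bigcap_measurable => // i _.
  by rewrite -[X in measurable X]setTI; exact: measurable_tnth.
by congr (_ * _)%E; apply: (IHn (fun i => A (lift ord0 i))) => i; exact: mA.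
Qed.

End lebesgue_tuple.
Arguments lebesgue_tuple {R} n.

Section entropy.
Context (R : realType).
Implicit Types (n K : nat).

(* [ln] vanishes on nonpositive reals, so 0 * log2 0 = 0. *)
Definition log2 (x : R) : R := ln x / ln 2.

Definition is_density n (f : n.-tuple R -> R) :=
  [/\ measurable_fun setT f, forall x, 0 <= f x &
      (\int[lebesgue_tuple n]_x (f x)%:E = 1)%E].

Definition diff_entropy n (f : n.-tuple R -> R) : \bar R :=
  (- \int[lebesgue_tuple n]_x (f x * log2 (f x))%:E)%E.

(* h(f) exists and is finite iff f log2 f is Lebesgue integrable. *)
Definition has_finite_entropy n (f : n.-tuple R -> R) :=
  (lebesgue_tuple n).-integrable setT (fun x => (f x * log2 (f x))%:E).

Definition mixture n K (pi : 'I_K -> R) (f : 'I_K -> n.-tuple R -> R)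
  (x : n.-tuple R) : R := \sum_(c < K) pi c * f c x.

(* P(C = c | X = x) where the mixture is positive; where it vanishes the value
   is 0 (division by 0) and is always multiplied by the mixture density 0. *)
Definition posterior n K (pi : 'I_K -> R) (f : 'I_K -> n.-tuple R -> R)
  (c : 'I_K) (x : n.-tuple R) : R := pi c * f c x / mixture pi f x.

Definition cond_diff_entropy n K (pi : 'I_K -> R)
  (f : 'I_K -> n.-tuple R -> R) : \bar R :=
  (\sum_(c < K) (pi c)%:E * diff_entropy (f c))%E.

Definition entropy K (pi : 'I_K -> R) : R :=
  - \sum_(c < K) pi c * log2 (pi c).

Definition cond_entropy n K (pi : 'I_K -> R)
  (f : 'I_K -> n.-tuple R -> R) : \bar R :=
  (- \int[lebesgue_tuple n]_x (mixture pi f x *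
     \sum_(c < K) posterior pi f c x * log2 (posterior pi f c x))%R%:E)%E.

Definition mutual_info n K (pi : 'I_K -> R)
  (f : 'I_K -> n.-tuple R -> R) : \bar R :=
  ((entropy pi)%:E - cond_entropy pi f)%E.

Definition cond_prob d (Omega : measurableType d) (P : probability Omega R)
  (A B : set Omega) : R := fine (P (A `&` B)) / fine (P B).

End entropy.

(* Main.v *)
(* Write p for the mixture density. Expanding log2 of the posterior
   pi_c f_c / p gives, at every point,
     p * sum_c post_c log2 post_c
       = sum_c (pi_c f_c log2 f_c + (pi_c log2 pi_c) f_c) - p log2 p.
   Finiteness of the entropies makes every term on the right integrable, so the
   identity can be integrated term by term, with int f_c = 1. *)
Require Import Defs.
From HB Require Import structures.
From mathcomp Require Import all_boot all_order all_algebra.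
From mathcomp Require Import all_classical all_reals all_analysis.
From mathcomp Require Import measurable_realfun ring.

Set Implicit Arguments.
Unset Strict Implicit.
Unset Printing Implicit Defensive.
Import Order.TTheory GRing.Theory Num.Theory.
Import numFieldNormedType.Exports.

Local Open Scope classical_set_scope.
Local Open Scope ring_scope.

Section posterior_entropy.
Context (R : realType).

Lemma log2M (x y : R) : 0 < x -> 0 < y -> log2 (x * y) = log2 x + log2 y.
Proof. by move=> x0 y0; rewrite /log2 lnM ?posrE// mulrDl. Qed.

Lemma log2V (x : R) : 0 < x -> log2 x^-1 = - log2 x.
Proof. by move=> x0; rewrite /log2 lnV ?posrE// mulNr. Qed.

(** The comparison is term by term in [c]. Where [f c x] is positive, so is the mixture, and the
    logarithm of the posterior splits. Where [f c x] vanishes both terms are 0, which covers every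
    point of zero mixture density. *)
Lemma mixture_posterior_log2 n K (pi : 'I_K -> R) (f : 'I_K -> n.-tuple R -> R)
    x :
  (forall c, 0 < pi c) -> (forall c, 0 <= f c x) ->
  mixture pi f x *
    (\sum_(c < K) posterior pi f c x * log2 (posterior pi f c x)) =
  \sum_(c < K) (pi c * (f c x * log2 (f c x)) + pi c * log2 (pi c) * f c x) -
  mixture pi f x * log2 (mixture pi f x).
Proof.
move=> pi0 f0; set p := mixture pi f x.
(* Only the factor in front of [log2 p] is expanded; the [p] inside the logarithm stays whole. *)
rewrite mulr_sumr {2}/p /mixture mulr_suml -sumrB.
apply: eq_bigr => c _; rewrite -/(mixture pi f x) -/p /posterior -/p.
have [fc0|fc0] := eqVneq (f c x) 0.
  by rewrite fc0 !(mulr0, mul0r) addr0 subr0.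
have fc_gt0 : 0 < f c x by rewrite lt_neqAle eq_sym fc0 f0.
have p_gt0 : 0 < p.
  (* The [c]-th summand is positive and the others are nonnegative. *)
  rewrite /p /mixture (bigD1 c)//= ltr_pwDl ?mulr_gt0//.
  by apply: sumr_ge0 => i _; rewrite mulr_ge0// ltW.
rewrite !log2M ?mulr_gt0 ?invr_gt0// log2V//.
by rewrite mulrA mulrCA divff ?gt_eqF//; ring.
Qed.

End posterior_entropy.

Theorem lemma1 (R : realType) (n K : nat) (n_ge1 : (1 <= n)%N)
  (K_ge1 : (1 <= K)%N)
  (pi : 'I_K -> R) (pi_gt0 : forall c, 0 < pi c)
  (pi_sum1 : \sum_(c < K) pi c = 1)
  (f : 'I_K -> n.-tuple R -> R) (f_density : forall c, is_density (f c))
  (d : measure_display) (Omega : measurableType d) (P : probability Omega R)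
  (C : Omega -> 'I_K)
  (C_measurable : forall c, measurable (C @^-1` [set c]))
  (C_law : forall c, P (C @^-1` [set c]) = (pi c)%:E)
  (X : {RV P >-> n.-tuple R})
  (X_law : forall (c : 'I_K) (A : set (n.-tuple R)), measurable A ->
    (cond_prob P (X @^-1` A) (C @^-1` [set c]))%:E =
    (\int[lebesgue_tuple n]_(x in A) (f c x)%:E)%E)
  (hX_finite : has_finite_entropy (mixture pi f))
  (hf_finite : forall c, has_finite_entropy (f c)) :
  diff_entropy (mixture pi f) =
  (cond_diff_entropy pi f + mutual_info pi f)%E.
Proof.
pose mu : {measure set (n.-tuple R) -> \bar R} := lebesgue_tuple n.
have f_integrable c : mu.-integrable setT (EFin \o f c).
  have [mf f0 f1] := f_density c; apply/integrableP; split.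
    exact/measurable_EFinP.
  under eq_integral => x _ do rewrite /= ger0_norm//.
  by rewrite [X in (X < _)%E]f1 ltry.
(* The integrals of [g c] will build [- h(X|C)], those of [h c] will build [- H(C)]. *)
pose g c (x : n.-tuple R) := (pi c * (f c x * log2 (f c x)))%:E.
pose h c (x : n.-tuple R) := (pi c * log2 (pi c) * f c x)%:E.
have g_integrable c : mu.-integrable setT (g c).
  exact: (integrableZl measurableT (pi c) (hf_finite c)).
have h_integrable c : mu.-integrable setT (h c).
  exact: (integrableZl measurableT (pi c * log2 (pi c)) (f_integrable c)).
have gh_integrable c : mu.-integrable setT (g c \+ h c)%E.
  exact: integrableD.
have hE c : (\int[mu]_x h c x = (pi c * log2 (pi c))%:E)%E.
  have [_ _ f1] := f_density c.
  under eq_integral do rewrite /h EFinM.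
  rewrite (integralZl measurableT (f_integrable c)) -[RHS]mule1; congr (_ * _)%E.
  exact: f1.
have gE c : (\int[mu]_x g c x = - ((pi c)%:E * diff_entropy (f c)))%E.
  under eq_integral do rewrite /g EFinM.
  by rewrite integralZl ?muleN ?oppeK//; exact: hf_finite.
(* Finite entropies allow the closing cancellation to take place in [R] rather than in [\bar R]. *)
have hf_fin c : diff_entropy (f c) \is a fin_num.
  by rewrite fin_numN; exact/integrable_fin_num/hf_finite.
have hX_fin : diff_entropy (mixture pi f) \is a fin_num.
  by rewrite fin_numN; exact/integrable_fin_num.
rewrite /mutual_info /entropy.
(* The last term is added because [diff_entropy] already carries the minus sign of [- p log2 p]. *)
have -> : cond_entropy pi f =
    (- (\sum_(c < K) (\int[mu]_x g c x + \int[mu]_x h c x)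
        + diff_entropy (mixture pi f)))%E.
  rewrite /cond_entropy; congr (- _)%E.
  transitivity (\int[mu]_x ((\sum_(c < K) (g c \+ h c) x)
      - (mixture pi f x * log2 (mixture pi f x))%:E))%E.
    apply: eq_integral => x _; rewrite mixture_posterior_log2//; last first.
      by move=> c; have [_ + _] := f_density c; exact.
    by rewrite EFinB sumEFin.
  rewrite integralB//; last exact: integrable_sum.
  rewrite integral_sum//; congr (_ + _)%E.
  by apply: eq_bigr => c _; rewrite integralD.
have -> : (\sum_(c < K) (\int[mu]_x g c x + \int[mu]_x h c x))%E =
    (\sum_(c < K) (pi c * log2 (pi c) - pi c * fine (diff_entropy (f c))))%:E.
  rewrite -sumEFin; apply: eq_bigr => c _.
  by rewrite gE hE -{1}(fineK (hf_fin c)) -EFinM -EFinN addeC.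
have -> : cond_diff_entropy pi f =
    (\sum_(c < K) pi c * fine (diff_entropy (f c)))%:E.
  rewrite /cond_diff_entropy -sumEFin; apply: eq_bigr => c _.
  by rewrite EFinM fineK.
(* On the right, [H(C)] cancels the sum of [pi c * log2 (pi c)], and [h(X|C)] cancels its negative,
   leaving [h(X)]. *)
rewrite -(fineK hX_fin) oppeK -!EFinD; congr EFin.
by rewrite sumrB; ring.
Qed.
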